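(* Let $p$ be a prime number and let $\overline{\mathbb{F}}_p$ be an algebraic closure of the field with $p$ elements. The set of accumulation points of Chern slopes of line arrangements over $\overline{\mathbb{F}}_p$ is the interval $[2,3]$.
   Context: For a field $k$, a line arrangement over $k$ is a finite collection of two or more (distinct) lines in the projective plane $\mathbb{P}^2_k$, a line being a set $\{[x,y,z]\in\mathbb{P}^2_k : ax+by+cz=0\}$ with $a,b,c\in k$ not all zero. For an arrangement $\mathcal{A}$ of $d$ lines and $m\ge 2$, $t_m$ denotes the number of points lying on exactly $m$ lines of $\mathcal{A}$. The Chern numbers of $\mathcal{A}$ are $$\bar{c}_1^2(\mathcal{A})= 9-5d+\sum_{m \geq 2} (3m-4) t_m, \qquad \bar{c}_2(\mathcal{A})= 3-2d + \sum_{m \geq 2} (m-1) t_m.$$ Standing assumption: all arrangements of $d$ lines considered satisfy $t_d=t_{d-1}=0$ (for such arrangements $\bar{c}_2>0$). The Chern slope of such an arrangement is $\bar{c}_1^2(\mathcal{A})/\bar{c}_2(\mathcal{A})$. An accumulation point of Chern slopes over $k$ is an accumulation point in $\mathbb{R}$ of the set of all Chern slopes of line arrangements over $k$ with $t_d=t_{d-1}=0$. *)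

(* Defs.v *)
From HB Require Import structures.
From mathcomp Require Import all_boot all_order all_algebra.
From mathcomp Require Import finmap.
From mathcomp Require Import all_classical all_reals all_analysis.

Set Implicit Arguments.
Unset Strict Implicit.
Unset Printing Implicit Defensive.

Import Order.TTheory GRing.Theory Num.Theory.
Import numFieldNormedType.Exports.

Local Open Scope fset_scope.
Local Open Scope classical_set_scope.
Local Open Scope ring_scope.

(* Points of P^2_k are the one-dimensional subspaces of k^3: the point
   [x, y, z] is the span of the nonzero row vector (x, y, z). *)
Record proj_plane (k : fieldType) := ProjPoint {
  proj_space : {vspace 'rV[k]_3};
  proj_spaceP : \dim proj_space == 1%N
}.
HB.instance Definition _ (k : fieldType) := [isSub for @proj_space k].
HB.instance Definition _ (k : fieldType) := [Choice of proj_plane k by <:].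

Definition line_of (k : fieldType) (u : 'rV[k]_3) : set (proj_plane k) :=
  [set P | exists2 v : 'rV[k]_3,
     proj_space P = <[v]>%VS & \sum_(i < 3) u 0 i * v 0 i = 0].

Definition is_line (k : fieldType) (L : set (proj_plane k)) : Prop :=
  exists2 u : 'rV[k]_3, u != 0 & L = line_of u.

Definition line_arrangement (k : fieldType) (A : {fset set (proj_plane k)})
    : Prop :=
  (2 <= #|` A|)%N /\ (forall L, L \in A -> is_line L).

Definition multiple_points (k : fieldType) (A : {fset set (proj_plane k)})
    (m : nat) : set (proj_plane k) :=
  [set P | #|` [fset L in A | P \in L]| = m].

(* [fset_set] sends an infinite set to the empty one; this is harmless since
   two distinct lines meet in one point, so that an arrangement has finitely
   many points of multiplicity m when m >= 2. *)
Definition tnum (k : fieldType) (A : {fset set (proj_plane k)}) (m : nat)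
    : nat :=
  #|` fset_set (multiple_points A m)|.

(* The sums over m >= 2 stop at m = d, as t_m = 0 for m > d. *)
Definition chern1sq (k : fieldType) (A : {fset set (proj_plane k)}) : int :=
  9 - 5 * (#|` A|)%:Z
  + \sum_(2 <= m < #|` A|.+1) (3 * m%:Z - 4) * (tnum A m)%:Z.

Definition chern2 (k : fieldType) (A : {fset set (proj_plane k)}) : int :=
  3 - 2 * (#|` A|)%:Z
  + \sum_(2 <= m < #|` A|.+1) (m%:Z - 1) * (tnum A m)%:Z.

Definition chern_slope (R : realType) (k : fieldType)
    (A : {fset set (proj_plane k)}) : R :=
  (chern1sq A)%:~R / (chern2 A)%:~R.

(* For d = 2 the index d - 1 is 1, outside the range where t_m is meaningful,
   but then t_d = 1 already excludes the arrangement. *)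
Definition chern_slopes (R : realType) (k : fieldType) : set R :=
  [set s | exists A : {fset set (proj_plane k)},
     [/\ line_arrangement A,
         tnum A #|` A| = 0%N,
         tnum A #|` A|.-1 = 0%N
       & s = chern_slope R A]].
Arguments chern_slopes : clear implicits.

Definition is_algebraic_closure (F : fieldType) (K : closedFieldType)
    (iota : {rmorphism F -> K}) : Prop :=
  forall x : K, algebraicOver iota x.

(* Main.v *)
(* With d lines, multiplicities m_P at the N multiple points P:

   - Upper bound: the slope is at most 3 iff d <= N, which is the theorem of de
     Bruijn and Erdos.
   - Lower bound: for a point of multiplicity r, counting the intersections of
     the r lines through it with the other d - r lines gives
     c2 >= (r - 2)(d - r - 1), while 2 c2 - c1^2 = d - 3 - sum (m_P - 2) is at
     most d - r - 1, so the slope is at least 2 - 1 / (r - 2).  If all m_P are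
     bounded, c2 grows like d^2 while 2 c2 - c1^2 <= d.  Hence slopes are at
     least 2 - eps for d large; and for bounded d there are finitely many.
   - Density: the q^2 lines y = a x + b with a, b in F_q have q^2 + q multiple
     points, all of multiplicity q.  Adding s general lines only creates nodes,
     and for q -> oo and s / q -> l the slope tends to 2 + 1 / (1 + l), which
     takes all values in (2, 3) for l > 0. *)
Require Import Defs.
From HB Require Import structures.
From mathcomp Require Import all_boot all_order all_algebra all_field.
From mathcomp Require Import finmap.
From mathcomp Require Import all_classical all_reals all_analysis.
From mathcomp Require Import zify ring lra.
Set Implicit Arguments.
Unset Strict Implicit.
Unset Printing Implicit Defensive.
Import Order.TTheory GRing.Theory Num.Theory.
Import numFieldNormedType.Exports.
Local Open Scope ring_scope.

(** * Incidence counts *)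

(** [T] stands for the lines and [U] for the points of a finite incidence structure, so that the
    counting arguments stay free of coordinates. *)
Definition degree (T U : finType) (inc : T -> U -> bool) (P : U) : nat :=
  #|[set L | inc L P]|.

Definition lines_meet (T U : finType) (inc : T -> U -> bool) : Prop :=
  forall L L', L != L' -> #|[set P | inc L P && inc L' P]| = 1%N.

(** Double counting: each pair of distinct lines is charged to its unique common point. *)
Lemma sum_pairs_through (T U : finType) (inc : T -> U -> bool) (R : rel T) :
    lines_meet inc -> (forall L L', R L L' -> L != L') ->
  (\sum_L \sum_(L' | R L L') 1 =
   \sum_P \sum_(L | inc L P) \sum_(L' | R L L' && inc L' P) 1)%N.
Proof.
move=> meet neqR.
under [RHS]eq_bigr do rewrite big_mkcond.
rewrite exchange_big /=; apply: eq_bigr => L _.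
transitivity (\sum_(L' | R L L') \sum_(P | inc L P && inc L' P) 1)%N.
  by apply: eq_bigr => L' /neqR/meet; rewrite -sum1dep_card => ->.
under eq_bigr do rewrite big_mkcondr /=.
rewrite exchange_big -[RHS]big_mkcond /=; apply: eq_bigr => P _.
by rewrite [RHS]big_mkcondr.
Qed.

(** For an arrangement this is the classical relation sum m (m - 1) t_m = d (d - 1). *)
Lemma sum_degree_pairs (T U : finType) (inc : T -> U -> bool) :
  lines_meet inc ->
  (\sum_P degree inc P * (degree inc P).-1 = #|T| * #|T|.-1)%N.
Proof.
move=> meet.
have -> : (#|T| * #|T|.-1 = \sum_(L : T) \sum_(L' | L' != L) 1)%N.
  rewrite -sum_nat_const; apply: eq_bigr => L _.
  by rewrite sum1_card cardC1.
rewrite (sum_pairs_through (R := fun L L' => L' != L) meet); last first.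
  by move=> L L'; rewrite eq_sym.
apply: eq_bigr => P _; rewrite /degree -[X in (X * _)%N]sum1dep_card big_distrl /=.
apply: eq_bigr => L LP; rewrite mul1n sum1dep_card.
rewrite (cardsD1 L) inE LP /=; apply: eq_card => L'.
by rewrite !inE.
Qed.

Lemma card_lines_through2 (T U : finType) (inc : T -> U -> bool) P Q :
  lines_meet inc -> P != Q -> (#|[set L | inc L P && inc L Q]| <= 1)%N.
Proof.
move=> meet neqPQ; apply/card_le1_eqP => L L'; rewrite !inE.
move=> /andP[LP LQ] /andP[L'P L'Q]; apply/eqP/negPn/negP => /meet.
move=> /eqP/cards1P[S /finset.setP eqS].
have := eqS P; rewrite !inE LP L'P => /esym/eqP eqPS.
by have := eqS Q; rewrite !inE LQ L'Q -eqPS eq_sym (negPf neqPQ).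
Qed.

(** Count the pairs of a line through [P] and a line missing it. Their common point Q differs from
    [P], and at most one line through Q passes through [P], so Q carries at most [(degree inc Q).-1]
    pairs. The term of [P] itself is left over, hence the extra summand. *)
Lemma degree_star (T U : finType) (inc : T -> U -> bool) (P : U) :
    lines_meet inc ->
  (degree inc P * (#|T| - degree inc P) + (degree inc P).-1
     <= \sum_Q (degree inc Q).-1)%N.
Proof.
move=> meet.
have -> : (degree inc P * (#|T| - degree inc P) =
    \sum_L \sum_(L' | inc L P && ~~ inc L' P) 1)%N.
  rewrite /degree -[X in (X * _)%N]sum1dep_card big_distrl /= big_mkcond /=.
  apply: eq_bigr => L _; case: ifP => [LP|_]; last by rewrite big_pred0.
  rewrite mul1n sum1dep_card -(cardsC [set L | inc L P]) addKn.
  by apply: eq_card => L'; rewrite !inE.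
rewrite (sum_pairs_through (R := fun L L' => inc L P && ~~ inc L' P) meet); last first.
  by move=> L L' /andP[LP]; apply: contraNneq => <-.
rewrite (bigD1 P) //= [X in (_ <= X)%N](bigD1 P) //=.
rewrite big1 ?add0n; last first.
  by move=> L _; rewrite big1 // => L'; case: (inc L' P); rewrite ?andbF.
rewrite addnC leq_add2l; apply: leq_sum => Q neqQP.
have le1 := card_lines_through2 meet neqQP.
have [|/finset.set0Pn[L0]] := eqVneq [set L | inc L Q && inc L P] finset.set0.
  move=> /finset.setP S0; rewrite big1 // => L LQ; rewrite big_pred0 // => L'.
  by move: (S0 L); rewrite !inE LQ /= => ->.
rewrite inE => /andP[L0Q L0P].
rewrite (bigD1 L0) //= [X in (_ + X)%N]big1 ?addn0; last first.
  move=> L /andP[LQ neqL]; rewrite big_pred0 // => L'.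
  have /negPf -> // : ~~ inc L P.
  apply: contraNN neqL => LP; apply/eqP.
  by apply: (card_le1_eqP le1); rewrite inE ?LQ ?L0Q.
rewrite sum1dep_card /degree [X in (_ <= X.-1)%N](cardsD1 L0) inE L0Q /=.
apply: subset_leq_card; apply/fintype.subsetP => L'.
by rewrite !inE L0P /= => /andP[]; case: eqVneq => // ->; rewrite L0P.
Qed.

(** Sending a line through [P] to its intersection with [L] is injective, since two lines through
    [P] meet nowhere else. *)
Lemma degree_le_points_on (T U : finType) (inc : T -> U -> bool) L P :
  lines_meet inc -> ~~ inc L P -> (degree inc P <= #|[set Q | inc L Q]|)%N.
Proof.
move=> meet LP; rewrite /degree -[X in (X <= _)%N]sum1dep_card.
have -> : (\sum_(L' | inc L' P) 1 =
    \sum_(L' | inc L' P) \sum_(Q | inc L Q && inc L' Q) 1)%N.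
  apply: eq_bigr => L' L'P; rewrite sum1dep_card meet //.
  by apply: contraNneq LP => ->.
under eq_bigr do rewrite big_mkcondr /=.
rewrite exchange_big /= -[X in (_ <= X)%N]sum1dep_card; apply: leq_sum => Q LQ.
rewrite -big_mkcondr /= sum1dep_card card_lines_through2 //.
by apply: contraNneq LP => ->.
Qed.

(* Conway's argument: if there were fewer points than lines, then
   1 = sum over non-incident (L, P) of 1 / (N (d - m_P)) would be smaller than
   1 = sum over non-incident (L, P) of 1 / (d (N - r_L)), as m_P <= r_L. *)
Lemma de_bruijn_erdos (T U : finType) (inc : T -> U -> bool) :
    lines_meet inc -> (forall P, 0 < degree inc P < #|T|)%N -> (1 < #|T|)%N ->
  (#|T| <= #|U|)%N.
Proof.
move=> meet degP T_gt1; rewrite leqNgt; apply/negP => ltUT.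
have exP L L' : L != L' -> exists P, inc L P && inc L' P.
  move=> /meet cardI; have /card_gt0P[P] : (0 < #|[set P | inc L P && inc L' P]|)%N.
    by rewrite cardI.
  by rewrite inE; exists P.
have exL P : exists L, ~~ inc L P.
  apply/existsP; rewrite -negb_forall; apply/negP => /forallP allP.
  have /andP[_] := degP P; rewrite /degree ltnNge => /negP; apply.
  rewrite -cardsT; apply: subset_leq_card; apply/fintype.subsetP => L.
  by rewrite !inE allP.
have exL' P : exists L, inc L P.
  have /andP[/card_gt0P[L]] := degP P.
  by rewrite inE => LP; exists L.
(* No line carries all points: otherwise take [L1] meeting [L] in P, and [L2] missing P; the point Q
   of [L1] on [L2] differs from P, and [L] and [L1] would share both. *)
have ltr L : (#|[set P | inc L P]| < #|U|)%N.
  rewrite ltnNge; apply/negP => leU.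
  have allL P : inc L P.
    have : [set P | inc L P] = [set: U].
      by apply/eqP; rewrite eqEcard finset.subsetT cardsT.
    by move=> /finset.setP/(_ P); rewrite !inE.
  have /card_gt0P[L1] : (0 < #|[set~ L]|)%N by rewrite cardsC1; lia.
  rewrite !inE eq_sym => neqL1; have /exP[P /andP[LP L1P]] := neqL1.
  have [L2 L2P] := exL P.
  have /exP[Q /andP[L1Q L2Q]] : L1 != L2 by apply: contraNneq L2P => <-.
  have neqPQ : P != Q by apply: contraNneq L2P => ->.
  have /card_le1_eqP : (#|[set L | inc L P && inc L Q]| <= 1)%N.
    exact: card_lines_through2.
  move=> /(_ L1 L); rewrite !inE L1P L1Q !allL => /(_ isT isT) eqL1.
  by move: neqL1; rewrite eqL1 eqxx.
pose d : rat := #|T|%:R; pose N : rat := #|U|%:R.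
pose m P : rat := (degree inc P)%:R.
pose r L : rat := (#|[set P | inc L P]|)%:R.
have [L0 _] : exists L : T, True.
  by have /card_gt0P[L] : (0 < #|T|)%N by [apply: ltnW]; exists L.
have /card_gt0P[P0 _] : (0 < #|U|)%N by apply: leq_ltn_trans (ltr L0).
have N_gt0 : (0 : rat) < N by rewrite ltr0n; apply/card_gt0P; exists P0.
have sum1P : \sum_P \sum_(L | ~~ inc L P) (N * (d - m P))^-1 = 1.
  transitivity (\sum_(P : U) N^-1).
    apply: eq_bigr => P _; rewrite sumr_const.
    have -> : #|[pred L | ~~ inc L P]| = (#|T| - degree inc P)%N.
      rewrite -(cardsC [set L | inc L P]) addKn.
      by apply: eq_card => L; rewrite !inE.
    rewrite -mulr_natr natrB; last by rewrite ltnW //; case/andP: (degP P).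
    rewrite invfM -mulrA mulVf ?mulr1 //.
    by rewrite subr_eq0 eqr_nat; have /andP[_ /gtn_eqF] := degP P => ->.
  by rewrite sumr_const -mulr_natr mulVf // gt_eqF.
have sum1L : \sum_L \sum_(P | ~~ inc L P) (d * (N - r L))^-1 = 1.
  transitivity (\sum_(L : T) d^-1).
    apply: eq_bigr => L _; rewrite sumr_const.
    have -> : #|[pred P | ~~ inc L P]| = (#|U| - #|[set P | inc L P]|)%N.
      rewrite -(cardsC [set P | inc L P]) addKn.
      by apply: eq_card => P; rewrite !inE.
    rewrite -mulr_natr natrB; last by rewrite ltnW // ltr.
    rewrite invfM -mulrA mulVf ?mulr1 //.
    by rewrite subr_eq0 eqr_nat; have /gtn_eqF := ltr L => ->.
  by rewrite sumr_const -mulr_natr mulVf // pnatr_eq0; lia.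
have : \sum_P \sum_(L | ~~ inc L P) (N * (d - m P))^-1 <
       \sum_L \sum_(P | ~~ inc L P) (d * (N - r L))^-1.
  rewrite [X in _ < X](exchange_big_dep xpredT) //=.
  apply: ltr_sum => [|P _]; first by apply/hasP; exists P0; rewrite ?mem_index_enum.
  apply: ltr_sum => [|L LP].
    by have [L LP] := exL P; apply/hasP; exists L; rewrite ?mem_index_enum.
  have rN : r L < N by rewrite ltr_nat.
  have mr : m P <= r L by rewrite ler_nat degree_le_points_on.
  have m0 : 0 < m P by rewrite ltr0n; case/andP: (degP P).
  have md : m P < d by rewrite ltr_nat; case/andP: (degP P).
  have Nd : N < d by rewrite ltr_nat.
  (* After cancelling d N, what remains is N m < d r, which follows from N < d and 0 < m <= r. *)
  rewrite ltf_pV2 ?posrE ?mulr_gt0 ?subr_gt0 //; nra.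
by rewrite sum1P sum1L ltxx.
Qed.

(** * Chern numbers of an incidence structure *)

Definition inc_chern1sq (T U : finType) (inc : T -> U -> bool) : int :=
  9 - 5 * #|T|%:Z + \sum_P (3 * (degree inc P)%:Z - 4).

Definition inc_chern2 (T U : finType) (inc : T -> U -> bool) : int :=
  3 - 2 * #|T|%:Z + \sum_P ((degree inc P)%:Z - 1).

Lemma sum_degreeB1 (T U : finType) (inc : T -> U -> bool) :
    (forall P, 0 < degree inc P)%N ->
  \sum_P ((degree inc P)%:Z - 1) = (\sum_P (degree inc P).-1)%N%:Z.
Proof.
move=> deg0; rewrite -natz natr_sum; apply: eq_bigr => Q _.
by have := deg0 Q; lia.
Qed.

(** [degree_star] gives the lower bound 3 - 2 d + r (d - r) + r - 1, which factors as (r - 2) (d - r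
    - 1). *)
Lemma inc_chern2_ge (T U : finType) (inc : T -> U -> bool) (P : U) :
    lines_meet inc -> (forall Q, 0 < degree inc Q)%N ->
  ((degree inc P)%:Z - 2) * (#|T|%:Z - (degree inc P)%:Z - 1)
    <= inc_chern2 inc.
Proof.
move=> meet deg0; have := degree_star P meet.
rewrite /inc_chern2 sum_degreeB1 //.
have := deg0 P; have : (degree inc P <= #|T|)%N by apply: max_card.
set S := (\sum_P _)%N; move: (degree inc P) #|T| => r d rd r0.
rewrite -lez_nat PoszD PoszM -subzn // predn_int //; nia.
Qed.

Lemma inc_chern2_le (T U : finType) (inc : T -> U -> bool) :
    lines_meet inc -> (forall Q, 0 < degree inc Q)%N -> (1 < #|T|)%N ->
  inc_chern2 inc <= (#|T| * #|T|)%N%:Z.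
Proof.
move=> meet deg0 T_gt1; rewrite /inc_chern2 sum_degreeB1 //.
have le : (\sum_P (degree inc P).-1 <= #|T| * #|T|.-1)%N.
  rewrite -(sum_degree_pairs meet); apply: leq_sum => P _.
  by rewrite leq_pmull.
nia.
Qed.

(** 3 c2 - c1^2 is the number of points minus the number of lines, so [de_bruijn_erdos] applies. *)
Lemma inc_chern_slope_le3 (T U : finType) (inc : T -> U -> bool) :
    lines_meet inc -> (forall P, 0 < degree inc P < #|T|)%N -> (1 < #|T|)%N ->
  inc_chern1sq inc <= 3 * inc_chern2 inc.
Proof.
move=> meet degP T_gt1; have le := de_bruijn_erdos meet degP T_gt1.
rewrite /inc_chern1sq /inc_chern2 mulrDr mulr_sumr.
have -> : \sum_P 3 * ((degree inc P)%:Z - 1) =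
   \sum_P (3 * (degree inc P)%:Z - 4) + #|U|%:Z.
  rewrite -natz -sumr_const -big_split /=.
  by apply: eq_bigr => P _; lia.
lia.
Qed.

(** When c2 > 0, the slope is below 2 exactly if this quantity is positive; points of multiplicity
    above 2 diminish it. *)
Lemma inc_chernB (T U : finType) (inc : T -> U -> bool) :
  2 * inc_chern2 inc - inc_chern1sq inc =
  #|T|%:Z - 3 - \sum_P ((degree inc P)%:Z - 2).
Proof.
rewrite /inc_chern1sq /inc_chern2 mulrDr mulr_sumr.
have -> : \sum_P 2 * ((degree inc P)%:Z - 1) =
   \sum_P (3 * (degree inc P)%:Z - 4) - \sum_P ((degree inc P)%:Z - 2).
  by rewrite -sumrB; apply: eq_bigr => P _; lia.
lia.
Qed.

(** Sum b (m - 1) >= m (m - 1) over the points and use [sum_degree_pairs]. *)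
Lemma inc_chern2_ge_bounded (T U : finType) (inc : T -> U -> bool) (b : nat) :
    lines_meet inc -> (forall P, 0 < degree inc P <= b)%N ->
  (#|T| * #|T|.-1)%N%:Z <= b%:Z * (inc_chern2 inc + 2 * #|T|%:Z - 3).
Proof.
move=> meet degb.
rewrite /inc_chern2 sum_degreeB1 => [|P]; last by case/andP: (degb P).
have : (#|T| * #|T|.-1 <= b * \sum_P (degree inc P).-1)%N.
  rewrite -(sum_degree_pairs meet) big_distrr /=; apply: leq_sum => P _.
  by rewrite leq_mul2r; case/andP: (degb P) => _ ->; rewrite orbT.
nia.
Qed.

(** A point of multiplicity at least 3 makes the product in [inc_chern2_ge] positive. Otherwise all
    points are nodes, and c2 >= (d - 2) (d - 3) / 2 with d >= 4. *)
Lemma inc_chern2_gt0 (T U : finType) (inc : T -> U -> bool) :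
    lines_meet inc -> (forall P, 1 < degree inc P <= #|T| - 2)%N ->
    (1 < #|T|)%N ->
  0 < inc_chern2 inc.
Proof.
move=> meet degP T_gt1.
have deg0 P : (0 < degree inc P)%N by have := degP P; lia.
have [/existsP[P P3]|] := boolP [exists P, 2 < degree inc P]%N.
  apply: lt_le_trans (inc_chern2_ge P meet deg0).
  by have := degP P; rewrite pmulr_rgt0; lia.
move=> /existsPn deg2.
have T4 : (4 <= #|T|)%N.
  have /card_gt1P[L [L' [_ _ /meet cardI]]] := T_gt1.
  have /card_gt0P[P _] : (0 < #|[set P | inc L P && inc L' P]|)%N by rewrite cardI.
  by have := degP P; lia.
have := @inc_chern2_ge_bounded _ _ inc 2 meet.
have deg02 P : (0 < degree inc P <= 2)%N by have := deg2 P; have := deg0 P; lia.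
move=> /(_ deg02); nia.
Qed.

(* Either some point has multiplicity at least k + 2, and the lines through it
   account for most of [inc_chern2], or all multiplicities are at most k + 1,
   and [inc_chern2] grows quadratically in the number of lines. *)
Lemma inc_chern_slope_ge (T U : finType) (inc : T -> U -> bool) (k : nat) :
    lines_meet inc -> (forall P, 1 < degree inc P <= #|T| - 2)%N ->
    ((k + 1) * (k + 2) < #|T|)%N ->
  k%:Z * (2 * inc_chern2 inc - inc_chern1sq inc) <= inc_chern2 inc.
Proof.
move=> meet degP dk.
have deg0 P : (0 < degree inc P)%N by have := degP P; lia.
have [/existsP[P Pk]|] := boolP [exists P, k.+1 < degree inc P]%N.
  apply: le_trans (inc_chern2_ge P meet deg0).
  (* Keeping only the term of [P] bounds 2 c2 - c1^2 by d - r - 1. *)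
  have leX : (degree inc P)%:Z - 2 <= \sum_Q ((degree inc Q)%:Z - 2).
    rewrite (bigD1 P) //= lerDl; apply: sumr_ge0 => Q _.
    by have := degP Q; lia.
  rewrite inc_chernB; have rd := degP P.
  apply: (@le_trans _ _ (k%:Z * (#|T|%:Z - (degree inc P)%:Z - 1))).
    by apply: ler_wpM2l; lia.
  by apply: ler_wpM2r; lia.
move=> /existsPn degk.
have {}degk P : (0 < degree inc P <= k.+1)%N.
  by have := deg0 P; have := degk P; lia.
have := inc_chern2_ge_bounded meet degk.
have : 2 * inc_chern2 inc - inc_chern1sq inc <= #|T|%:Z - 3.
  rewrite inc_chernB gerBl; apply: sumr_ge0 => Q _.
  by have := degP Q; lia.
nia.
Qed.

(** * Lines of the projective plane *)

Local Open Scope fset_scope.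
Local Open Scope classical_set_scope.
Local Open Scope ring_scope.

Definition dot3 (k : fieldType) (u v : 'rV[k]_3) : k :=
  \sum_(i < 3) u 0 i * v 0 i.

Lemma dot3E (k : fieldType) (u v : 'rV[k]_3) :
  dot3 u v = u 0 0 * v 0 0 + u 0 1 * v 0 1 + u 0 2 * v 0 2.
Proof.
rewrite /dot3 !big_ord_recl big_ord0 addr0 addrA.
by do 3?congr (_ + _); congr (u _ _ * v _ _); apply: val_inj.
Qed.

Lemma dot3Z (k : fieldType) (u v : 'rV[k]_3) c : dot3 u (c *: v) = c * dot3 u v.
Proof. by rewrite !dot3E !mxE; ring. Qed.

Lemma row3P (k : fieldType) (u v : 'rV[k]_3) :
  u 0 0 = v 0 0 -> u 0 1 = v 0 1 -> u 0 2 = v 0 2 -> u = v.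
Proof.
move=> e0 e1 e2; apply/rowP => -[[|[|[|//]]] lt_i].
- by have -> : Ordinal lt_i = 0 by apply: val_inj.
- by have -> : Ordinal lt_i = 1 by apply: val_inj.
- by have -> : Ordinal lt_i = 2 by apply: val_inj.
Qed.

Definition row3 (k : fieldType) (a b c : k) : 'rV[k]_3 :=
  \row_(i < 3) [:: a; b; c]`_i.

Definition cross3 (k : fieldType) (u v : 'rV[k]_3) : 'rV[k]_3 :=
  row3 (u 0 1 * v 0 2 - u 0 2 * v 0 1)
       (u 0 2 * v 0 0 - u 0 0 * v 0 2)
       (u 0 0 * v 0 1 - u 0 1 * v 0 0).

Lemma dot3_crossl (k : fieldType) (u v : 'rV[k]_3) : dot3 u (cross3 u v) = 0.
Proof. by rewrite dot3E !mxE /=; ring. Qed.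

Lemma dot3_crossr (k : fieldType) (u v : 'rV[k]_3) : dot3 v (cross3 u v) = 0.
Proof. by rewrite dot3E !mxE /=; ring. Qed.

Lemma cross3_eq0 (k : fieldType) (u v : 'rV[k]_3) :
  u != 0 -> cross3 u v = 0 -> exists c, v = c *: u.
Proof.
move=> u0 /rowP uv.
have e0 := uv 0; have e1 := uv 1; have e2 := uv 2.
move: e0 e1 e2; rewrite !mxE /= => /eqP + /eqP + /eqP; rewrite !subr_eq0.
move=> /eqP e0 /eqP e1 /eqP e2.
have [u00|u00] := eqVneq (u 0 0) 0; last first.
  exists (v 0 0 / u 0 0); apply: row3P; rewrite !mxE; apply: (mulfI u00).
  - by field.
  - by rewrite e2; field.
  - by rewrite -e1; field.
have [u01|u01] := eqVneq (u 0 1) 0; last first.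
  exists (v 0 1 / u 0 1); apply: row3P; rewrite !mxE; apply: (mulfI u01).
  - by rewrite -e2; field.
  - by field.
  - by rewrite e0; field.
have u02 : u 0 2 != 0.
  by apply: contraNneq u0 => u02; apply/eqP/row3P; rewrite !mxE.
exists (v 0 2 / u 0 2); apply: row3P; rewrite !mxE; apply: (mulfI u02).
- by rewrite e1; field.
- by rewrite -e0; field.
- by field.
Qed.

(** By the triple product identity (u x v) x w = (u.w) v - (v.w) u, the vector [w] is parallel to
    [cross3 u v]. *)
Lemma dot3_cross (k : fieldType) (u v w : 'rV[k]_3) :
  cross3 u v != 0 -> dot3 u w = 0 -> dot3 v w = 0 -> exists c, w = c *: cross3 u v.
Proof.
move=> c0 uw vw; apply: cross3_eq0 => //.
have -> : cross3 (cross3 u v) w = dot3 u w *: v - dot3 v w *: u.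
  by rewrite !dot3E; apply: row3P; rewrite !mxE /=; ring.
by rewrite uw vw !scale0r subr0.
Qed.

Lemma vline_eq (k : fieldType) (v w : 'rV[k]_3) :
  v != 0 -> (<[v]> = <[w]>)%VS <-> exists2 c, c != 0 & w = c *: v.
Proof.
move=> v0; split=> [vw|[c c0 ->]].
  have /vlineP[c wE] : w \in <[v]>%VS by rewrite vw memv_line.
  exists c => //; apply: contraNneq v0 => c0.
  by rewrite -memv0; move: (memv_line v); rewrite vw wE c0 scale0r.
apply/eqP; rewrite eqEsubv -!memvE; apply/andP; split; last first.
  by rewrite memvZ // memv_line.
by apply/vlineP; exists c^-1; rewrite scalerA mulVf // scale1r.
Qed.

Lemma pt0_subproof (k : fieldType) : \dim <[row3 (1 : k) 0 0]> == 1%N.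
Proof.
have : row3 (1 : k) 0 0 != 0 by apply/eqP => /matrixP/(_ 0 0)/eqP; rewrite !mxE oner_eq0.
by rewrite dim_vline => ->.
Qed.

(* Junk value [1 : 0 : 0] at [v = 0]. *)
Definition pt (k : fieldType) (v : 'rV[k]_3) : proj_plane k :=
  insubd (ProjPoint (pt0_subproof k)) <[v]>%VS.

Lemma proj_space_pt (k : fieldType) (v : 'rV[k]_3) :
  v != 0 -> proj_space (pt v) = <[v]>%VS.
Proof. by move=> v0; rewrite [LHS]insubdK // -topredE /= dim_vline v0. Qed.

Lemma ptP (k : fieldType) (P : proj_plane k) : exists2 v, v != 0 & P = pt v.
Proof.
have dimP := proj_spaceP P; pose v := vpick (proj_space P).
have v0 : v != 0 by rewrite vpick0 -dimv_eq0 (eqP dimP).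
exists v => //; apply: val_inj; rewrite /= proj_space_pt //; apply/eqP.
rewrite eq_sym eqEdim -memvE memv_pick /=.
by rewrite (eqP dimP) dim_vline v0.
Qed.

Lemma pt_eq (k : fieldType) (v w : 'rV[k]_3) : v != 0 -> w != 0 ->
  pt v = pt w <-> exists c, w = c *: v.
Proof.
move=> v0 w0; split=> [/(congr1 (@proj_space k))|[c wE]].
  by rewrite !proj_space_pt // => /(vline_eq _ v0)[c _ ->]; exists c.
apply: val_inj; rewrite /= !proj_space_pt //; apply/(vline_eq _ v0).
by exists c => //; apply: contraNneq w0 => c0; rewrite wE c0 scale0r.
Qed.

Lemma line_of_pt (k : fieldType) (u v : 'rV[k]_3) : v != 0 ->
  (pt v \in line_of u) = (dot3 u v == 0).
Proof.
move=> v0; apply/idP/eqP; rewrite in_setE; last first.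
  by exists v => //; rewrite proj_space_pt.
move=> [w]; rewrite proj_space_pt // => /(vline_eq _ v0)[c c0 ->] /eqP.
by rewrite -/(dot3 _ _) dot3Z mulf_eq0 (negPf c0) => /eqP.
Qed.

(** The cross product of the two normal vectors spans the common point; it is nonzero, as
    proportional normals define equal lines. *)
Lemma lines_meet_at (k : fieldType) (L L' : set (proj_plane k)) :
  is_line L -> is_line L' -> L != L' ->
  exists P, forall Q, (Q \in L) && (Q \in L') = (Q == P).
Proof.
move=> [u u0 ->] [v v0 ->] neqL.
have c0 : cross3 u v != 0.
  apply: contraNneq neqL => /(cross3_eq0 u0)[c vE]; apply/eqP/seteqP.
  have cn0 : c != 0 by apply: contraNneq v0 => c0; rewrite vE c0 scale0r.
  have eqm Q : (Q \in line_of u) = (Q \in line_of v).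
    have [w w0 ->] := ptP Q; rewrite !line_of_pt // vE !dot3E !mxE.
    by rewrite -!mulrA -!mulrDr mulf_eq0 (negPf cn0).
  by split=> Q /mem_set QL; apply/set_mem; rewrite ?eqm // -eqm.
exists (pt (cross3 u v)) => Q; have [w w0 ->] := ptP Q.
rewrite !line_of_pt //; apply/andP/eqP => [[/eqP uw /eqP vw]|/(pt_eq w0 c0)[c cE]].
  by apply/esym/(pt_eq c0 w0); apply: dot3_cross.
have cn0 : c != 0.
  by apply: contraNneq c0 => c0; rewrite cE c0 scale0r.
split; apply/eqP/(mulfI cn0); rewrite mulr0 -dot3Z -cE.
  exact: dot3_crossl.
exact: dot3_crossr.
Qed.

(** * Chern numbers as sums over multiple points *)

Definition meet_pt (k : fieldType) (L L' : set (proj_plane k)) : proj_plane k :=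
  xget (pt 0) [set P | (P \in L) && (P \in L')].

Lemma meet_ptP (k : fieldType) (L L' : set (proj_plane k)) Q :
  is_line L -> is_line L' -> L != L' ->
  (Q \in L) && (Q \in L') = (Q == meet_pt L L').
Proof.
move=> lL lL' /(lines_meet_at lL lL')[P PP].
have /eqP -> : meet_pt L L' == P; last exact: PP.
have exP : exists Q, [set Q | (Q \in L) && (Q \in L')] Q.
  by exists P; rewrite /= PP.
by rewrite -PP; apply: (xgetPex _ exP).
Qed.

Definition mult (k : fieldType) (A : {fset set (proj_plane k)})
    (P : proj_plane k) : nat := #|` [fset L in A | P \in L]|.

Definition multi (k : fieldType) (A : {fset set (proj_plane k)}) :
    {fset proj_plane k} := fset_set [set P | (1 < mult A P)%N].

Lemma multP (k : fieldType) (A : {fset set (proj_plane k)}) P :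
  (1 < mult A P)%N <->
  exists L L', [/\ L \in A, L' \in A, L != L', P \in L & P \in L'].
Proof.
split=> [|[L [L' [LA L'A neqL PL PL']]]].
  rewrite /mult cardfE => /card_gt1P[L [L' [_ _ neqL]]].
  have := fsvalP L; have := fsvalP L'; rewrite !inE /=.
  move=> /andP[L'A PL'] /andP[LA PL]; exists (val L), (val L'); split => //.
apply: leq_trans (_ : (#|` [fset L; L']| <= _)%N); first by rewrite cardfs2 neqL.
apply: fsubset_leq_card; apply/fsubsetP => L0; rewrite !inE.
by move=> /orP[] /eqP ->; rewrite ?LA ?L'A.
Qed.

(** Every multiple point is the intersection of two lines of [A]. This makes [multi] faithful, as
    [fset_set] empties infinite sets. *)
Lemma finite_multi (k : fieldType) (A : {fset set (proj_plane k)}) :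
  line_arrangement A -> finite_set [set P | (1 < mult A P)%N].
Proof.
move=> [_ linA].
apply: (@sub_finite_set _ _ ((fun LL => meet_pt LL.1 LL.2) @`
   ([set` A] `*` [set` A]))); last first.
  by apply/finite_image/finite_setX; apply: finite_fset.
move=> P /= /multP[L [L' [LA L'A neqL PL PL']]]; exists (L, L') => //=.
by apply/esym/eqP; rewrite -meet_ptP ?PL //; apply: linA.
Qed.

Lemma in_multi (k : fieldType) (A : {fset set (proj_plane k)}) P :
  line_arrangement A -> (P \in multi A) = (1 < mult A P)%N.
Proof.
move=> linA; rewrite in_fset_set; last exact: finite_multi.
by apply/idP/idP; rewrite in_setE.
Qed.

Lemma mult_le (k : fieldType) (A : {fset set (proj_plane k)}) P :
  (mult A P <= #|` A|)%N.
Proof. by apply: fsubset_leq_card; apply: fset_sub. Qed.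

Lemma tnum_multi (k : fieldType) (A : {fset set (proj_plane k)}) m :
  line_arrangement A -> (1 < m)%N ->
  tnum A m = #|` [fset P in multi A | mult A P == m]|.
Proof.
move=> linA m1; rewrite /tnum; congr #|` _|; apply/fsetP => P.
rewrite in_fset_set; last first.
  apply: sub_finite_set (finite_multi linA) => Q /= mQ.
  by rewrite /mult mQ.
rewrite !inE in_multi //=; apply/idP/idP; rewrite in_setE.
  by move=> mP; rewrite /mult mP eqxx m1.
by move=> /andP[_ /eqP].
Qed.

(** Group the multiple points by multiplicity, which lies between 2 and d. *)
Lemma sum_tnum (k : fieldType) (A : {fset set (proj_plane k)}) (g : nat -> int) :
  line_arrangement A ->
  \sum_(2 <= m < #|` A|.+1) g m * (tnum A m)%:Z = \sum_(P <- multi A) g (mult A P).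
Proof.
move=> linA; transitivity (\sum_(2 <= m < #|` A|.+1)
    \sum_(P <- multi A | mult A P == m) g (mult A P)).
  apply: eq_big_nat => m /andP[m1 _].
  rewrite tnum_multi // card_fset_sum1 -big_fset_condE -natz natr_sum mulr_sumr.
  by apply: eq_bigr => P /eqP ->; rewrite mulr1.
rewrite (exchange_big_dep xpredT) //=; apply: eq_big_seq => P.
rewrite in_multi // => mP; under eq_bigl do rewrite eq_sym.
by rewrite big_nat1_eq mP ltnS mult_le.
Qed.

Definition inc_of (k : fieldType) (A : {fset set (proj_plane k)})
    (L : A) (P : multi A) : bool := val P \in val L.

Lemma degree_inc_of (k : fieldType) (A : {fset set (proj_plane k)}) (P : multi A) :
  degree (@inc_of k A) P = mult A (val P).
Proof.
rewrite /degree /mult card_fset_sum1 -big_fset_condE big_seq_fsetE /=.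
by rewrite sum1dep_card.
Qed.

(** Restricting to multiple points loses no intersection: the common point of two lines of [A] is
    itself multiple. *)
Lemma lines_meet_inc_of (k : fieldType) (A : {fset set (proj_plane k)}) :
  line_arrangement A -> lines_meet (@inc_of k A).
Proof.
move=> linA L L' neqL; have [_ isl] := linA.
have meetE := fun Q => meet_ptP Q (isl _ (fsvalP L)) (isl _ (fsvalP L')) neqL.
have MP : meet_pt (val L) (val L') \in multi A.
  rewrite in_multi //; apply/multP; exists (val L), (val L').
  have := meetE (meet_pt (val L) (val L')); rewrite eqxx => /andP[PL PL'].
  by split=> //; apply: fsvalP.
rewrite -(cards1 [` MP]); apply: eq_card => Q; rewrite !inE /inc_of meetE.
by apply/eqP/eqP => [QP|->//]; apply: val_inj.
Qed.

Lemma chern1sq_inc (k : fieldType) (A : {fset set (proj_plane k)}) :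
  line_arrangement A -> chern1sq A = inc_chern1sq (@inc_of k A).
Proof.
move=> linA; rewrite /chern1sq /inc_chern1sq cardfE; congr (_ + _).
rewrite -cardfE (sum_tnum (fun m => 3 * m%:Z - 4) linA) big_seq_fsetE /=.
by apply: eq_bigr => P _; rewrite degree_inc_of.
Qed.

Lemma chern2_inc (k : fieldType) (A : {fset set (proj_plane k)}) :
  line_arrangement A -> chern2 A = inc_chern2 (@inc_of k A).
Proof.
move=> linA; rewrite /chern2 /inc_chern2 cardfE; congr (_ + _).
rewrite -cardfE (sum_tnum (fun m => m%:Z - 1) linA) big_seq_fsetE /=.
by apply: eq_bigr => P _; rewrite degree_inc_of.
Qed.

Lemma tnum_eq0 (k : fieldType) (A : {fset set (proj_plane k)}) m :
  line_arrangement A -> (1 < m)%N ->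
  tnum A m = 0%N <-> (forall P, mult A P != m).
Proof.
move=> linA m1; rewrite tnum_multi //; split=> [/eqP|noP].
  rewrite cardfs_eq0 => /eqP/fsetP S0 P; apply/negP => /eqP mP.
  by have := S0 P; rewrite !inE in_multi //= mP m1 eqxx.
apply/eqP; rewrite cardfs_eq0; apply/eqP/fsetP => P; rewrite !inE /=.
by rewrite (negPf (noP P)) andbF.
Qed.

Lemma degree_inc_of_bounds (k : fieldType) (A : {fset set (proj_plane k)}) :
    line_arrangement A -> tnum A #|` A| = 0%N -> tnum A #|` A|.-1 = 0%N ->
  forall P, (1 < degree (@inc_of k A) P <= #|{: A}| - 2)%N.
Proof.
move=> linA td td1 P; rewrite degree_inc_of -cardfE.
have : val P \in multi A by apply: fsvalP.
rewrite in_multi //; move: (val P) => {}P m1; rewrite m1 /=.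
have := mult_le A P; have [d2 _] := linA.
have := (tnum_eq0 linA d2).1 td P.
(* If d = 2, then t_d = 0 already contradicts a multiplicity between 2 and d. *)
have [d3|d3] := leqP 3 #|` A|; last by lia.
have d3' : (1 < #|` A|.-1)%N by lia.
have aux m d : (2 < d)%N -> m != d.-1 -> m != d -> (m <= d)%N -> (m <= d - 2)%N.
  by lia.
exact: (aux _ _ d3 ((tnum_eq0 linA d3').1 td1 P)).
Qed.

(** * General lines and lines over a finite field *)

(** Try the lines x + t y + t^2 z = 0. Passing through a given point makes t a root of a nonzero
    polynomial, and an algebraically closed field has an element that is no root of the product of
    these polynomials. *)
Lemma exists_avoiding_line (K : closedFieldType) (M : {fset proj_plane K}) :
  exists2 L, is_line L & forall P, P \in M -> P \notin L.
Proof.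
pose rep P : 'rV[K]_3 := xget 0 [set v | v != 0 /\ P = pt v].
have repP P : rep P != 0 /\ P = pt (rep P).
  have [v v0 Pv] := ptP P.
  have exv : exists w, [set v | v != 0 /\ P = pt v] w by exists v.
  exact: (xgetPex _ exv).
pose f P : {poly K} := Poly [:: rep P 0 0; rep P 0 1; rep P 0 2].
have : \prod_(P <- M) f P != 0.
  rewrite prodf_seq_neq0; apply/allP => P _ /=; apply/eqP => /polyP fP.
  have [/eqP + _] := repP P; apply; apply: row3P; rewrite mxE.
  - by have := fP 0%N; rewrite coef_Poly coef0.
  - by have := fP 1%N; rewrite coef_Poly coef0.
  - by have := fP 2%N; rewrite coef_Poly coef0.
move=> /closed_nonrootP[t]; rewrite /root horner_prod prodf_seq_neq0 => /allP roott.
exists (line_of (row3 1 t (t ^+ 2))).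
  exists (row3 1 t (t ^+ 2)) => //; apply/eqP => /matrixP/(_ 0 0)/eqP.
  by rewrite !mxE oner_eq0.
move=> P PM; have [v0 {1}->] := repP P; rewrite line_of_pt //.
apply: contraNN (roott _ PM); rewrite dot3E !mxE /root horner_Poly /=.
by congr (_ == 0); ring.
Qed.

Lemma mult_fsetU1 (k : fieldType) (A : {fset set (proj_plane k)}) L P :
  L \notin A -> mult (L |` A)%fset P = ((P \in L) + mult A P)%N.
Proof.
move=> LA; rewrite /mult !card_fset_sum1 -!big_fset_condE big_mkcond /=.
by rewrite big_fsetU1 //= -big_mkcond; case: (P \in L).
Qed.

(** A line avoiding all multiple points meets the lines of [A] in pairwise distinct simple points,
    so it creates exactly d nodes and leaves the old multiple points as they were. *)
Lemma add_generic_line (K : closedFieldType) (A : {fset set (proj_plane K)}) :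
    line_arrangement A ->
  exists A', [/\ line_arrangement A', #|` A'| = #|` A|.+1,
    (forall g : nat -> int, \sum_(P <- multi A') g (mult A' P) =
       \sum_(P <- multi A) g (mult A P) + #|` A|%:Z * g 2%N)
  & forall P, (mult A' P <= maxn 2 (mult A P))%N].
Proof.
move=> linA; have [d2 isl] := linA.
have [L lL avoid] := exists_avoiding_line (multi A).
have mL P : P \in L -> (mult A P <= 1)%N.
  by move=> PL; rewrite leqNgt -in_multi //; apply: contraTN PL => /avoid.
(* If the new line were in [A], any other line of [A] would meet it in a multiple point, so it would
   be alone in [A], against d >= 2. *)
have neqL L' : L' \in A -> L != L'.
  move=> L'A; apply: contraTneq d2 => eqL; rewrite -leqNgt.
  have -> : A = [fset L']; last by rewrite cardfs1.
  apply/fsetP => L2; rewrite inE; apply/idP/eqP => [L2A|-> //].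
  apply/eqP; apply: contraT => neqL2.
  have := meet_ptP (meet_pt L2 L') (isl _ L2A) (isl _ L'A) neqL2.
  rewrite eqxx => /andP[P2 P']; have : meet_pt L2 L' \in L by rewrite eqL.
  move=> /mL; rewrite leqNgt => /negP[]; apply/multP.
  by exists L2, L'; split.
have LA : L \notin A by apply/negP => /neqL; rewrite eqxx.
have linA' : line_arrangement (L |` A)%fset.
  split=> [|L']; first by rewrite cardfsU1 LA ltnW.
  by rewrite !inE => /orP[/eqP ->//|/isl].
have meetL L' Q : L' \in A -> (Q \in L) && (Q \in L') = (Q == meet_pt L L').
  by move=> L'A; apply: meet_ptP; [|exact: isl|exact: neqL].
have multE P L' : L' \in A -> P \in L -> P \in L' -> mult A P = 1%N.
  move=> L'A PL PL'; apply/eqP; rewrite eqn_leq mL // cardfs_gt0.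
  by apply/fset0Pn; exists L'; rewrite !inE L'A.
exists (L |` A)%fset; split=> // [|g|P].
- by rewrite cardfsU1 LA.
- have injL : {in A &, injective (meet_pt L)}.
    move=> L1 L2 L1A L2A eqP12; apply/eqP; apply: contraT => neqL12.
    have := meetL L1 (meet_pt L L1) L1A; rewrite eqxx => /andP[PL PL1].
    have := meetL L2 (meet_pt L L2) L2A; rewrite eqxx -eqP12 => /andP[_ PL2].
    have := mL _ PL; rewrite leqNgt => /negP[]; apply/multP.
    by exists L1, L2; split.
  have meetE L' : L' \in A -> [/\ meet_pt L L' \in L, meet_pt L L' \in L' &
       mult A (meet_pt L L') = 1%N].
    move=> L'A; have := meetL L' (meet_pt L L') L'A; rewrite eqxx => /andP[PL PL'].
    by split=> //; apply: (multE _ L').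
  (* Off the new line the multiple points are those of [A]; on it they are its intersections with
     the lines of [A], all of multiplicity 2. *)
  rewrite (big_fsetID _ [pred P | P \in L]) /= addrC; congr (_ + _).
    apply: eq_fbig_cond => [P|P + _].
      rewrite !inE !in_multi //= mult_fsetU1 //.
      have [PL|PL] := boolP (P \in L); last by rewrite andbT.
      by rewrite andbF ltnNge mL.
    by rewrite inE mult_fsetU1 // => /andP[_ /negPf ->].
  transitivity (\sum_(P <- [fset meet_pt L L' | L' in A]) g 2%N).
    apply: eq_fbig_cond => [P|P + _].
      rewrite !inE !andbT -[RHS]/(P \in [fset meet_pt L L' | L' in A]).
      rewrite in_multi //= mult_fsetU1 //; apply/andP/imfsetP => /=.
        move=> [+ PL]; rewrite PL add1n ltnS cardfs_gt0 => /fset0Pn[L'].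
        rewrite !inE => /andP[L'A PL']; exists L' => //.
        by apply/eqP; rewrite -meetL // PL.
      by move=> [L' /= L'A ->]; have [-> _ ->] := meetE _ L'A.
    rewrite !inE in_multi //= => /andP[/[swap] PL]; rewrite mult_fsetU1 // PL.
    by have := mL _ PL; case: (mult A P) => [|[|]].
  rewrite big_imfset //= big_const_seq count_predT -Monoid.iteropE /=.
  by rewrite -natz mulr_natl.
- rewrite mult_fsetU1 //; have [PL|PL] := boolP (P \in L).
    by have := mL _ PL; lia.
  by rewrite leq_maxr.
Qed.

(** The successive lines create d, d + 1, ..., d + s - 1 nodes. *)
Lemma add_generic_lines (K : closedFieldType) (A : {fset set (proj_plane K)})
    (s : nat) : line_arrangement A ->
  exists A', [/\ line_arrangement A', #|` A'| = (#|` A| + s)%N,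
    (forall g : nat -> int, \sum_(P <- multi A') g (mult A' P) =
       \sum_(P <- multi A) g (mult A P) + (s * #|` A| + 'C(s, 2))%N%:Z * g 2%N)
  & forall P, (mult A' P <= maxn 2 (mult A P))%N].
Proof.
move=> linA; elim: s => [|s [A1 [linA1 cA1 gA1 mA1]]].
  exists A; split=> // [|g|P]; rewrite ?addn0 ?leq_maxr //.
  by rewrite mul0n mul0r addr0.
have [A2 [linA2 cA2 gA2 mA2]] := add_generic_line linA1.
exists A2; split=> // [|g|P]; first by rewrite cA2 cA1 addnS.
  rewrite gA2 gA1 cA1 -addrA -mulrDl -PoszD; congr (_ + Posz _ * _).
  by rewrite binS bin1; lia.
by have := mA2 P; have := mA1 P; lia.
Qed.

(** * Lines with coefficients in a finite subfield *)

Definition subfield_closed (K : fieldType) (S : seq K) : Prop :=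
  [/\ {in S &, forall x y, x - y \in S}, {in S &, forall x y, x * y \in S}
    & {in S, forall x, x^-1 \in S}].

(** [S] lists the roots of X^q - X for q = p^n. They are distinct because the derivative is -1, and
    form a field because x -> x^q is additive in characteristic p. *)
Lemma frobenius_fixed_points (K : closedFieldType) (p n : nat) :
    p \in [pchar K] -> (0 < n)%N ->
  exists S : seq K, [/\ uniq S, size S = (p ^ n)%N & subfield_closed S].
Proof.
move=> pK n0; set q := (p ^ n)%N.
have p_prime : prime p := pcharf_prime pK.
have q1 : (1 < q)%N by rewrite -(exp1n n) ltn_exp2r ?prime_gt1.
pose f : {poly K} := 'X^q - 'X.
have szf : size f = q.+1.
  by rewrite size_polyDl size_polyXn // size_polyN size_polyX.
have mf : f \is monic.
  by rewrite monicE lead_coefDl ?lead_coefXn // size_polyXn size_polyN size_polyX.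
have [S fE] := closed_field_poly_normal f.
rewrite (monicP mf) scale1r in fE.
have memS x : (x \in S) = (x ^+ q == x).
  by rewrite -root_prod_XsubC -fE /root !hornerE subr_eq0.
have qpow x y : (x - y) ^+ q = x ^+ q - y ^+ q :> K.
  have qnat : [pchar K].-nat q by rewrite pnatX pnatE ?pK.
  by rewrite exprDn_pchar // exprNn_pchar.
exists S; split.
- rewrite -separable_prod_XsubC -fE separable_poly.unlock derivB derivXn derivX.
  rewrite -scaler_nat natrX (pcharf0 pK) expr0n gtn_eqF //= scale0r sub0r.
  by rewrite -scaleN1r coprimepZr ?coprimep1 ?oppr_eq0 ?oner_eq0.
- by apply: succn_inj; rewrite -szf fE size_prod_XsubC.
split=> [x y|x y|x]; rewrite !memS.
- by move=> /eqP xq /eqP yq; rewrite qpow xq yq.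
- by move=> /eqP xq /eqP yq; rewrite exprMn xq yq.
- by move=> /eqP xq; rewrite exprVn xq.
Qed.

(** The points [0 : b : 1] and [1 : a : 0] of the line determine its intercept and its slope. *)
Lemma line_of_affine_inj (k : fieldType) (a b a' b' : k) :
  line_of (row3 a (-1) b) = line_of (row3 a' (-1) b') -> a = a' /\ b = b'.
Proof.
move=> eqL; have n0 : row3 0 b 1 != 0.
  by apply/eqP => /matrixP/(_ 0 2)/eqP; rewrite !mxE oner_eq0.
have n1 : row3 1 a 0 != 0.
  by apply/eqP => /matrixP/(_ 0 0)/eqP; rewrite !mxE oner_eq0.
have : pt (row3 0 b 1) \in line_of (row3 a (-1) b).
  by rewrite line_of_pt // dot3E !mxE /=; apply/eqP; ring.
have : pt (row3 1 a 0) \in line_of (row3 a (-1) b).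
  by rewrite line_of_pt // dot3E !mxE /=; apply/eqP; ring.
rewrite eqL !line_of_pt // !dot3E !mxE /= => /eqP e1 /eqP e2.
by split; apply/eqP; rewrite -subr_eq0; apply/eqP; rewrite -[RHS]oppr0;
  [rewrite -e1|rewrite -e2]; ring.
Qed.

(** Take the lines y = a x + b with a, b in [S]. Their multiple points are those of S x S, each on
    one line of every slope, and the points at infinity [1 : a : 0], one for each class of
    parallels. *)
Lemma affine_lines_arrangement (k : fieldType) (S : seq k) :
    uniq S -> (1 < size S)%N -> subfield_closed S ->
  exists A : {fset set (proj_plane k)}, [/\ line_arrangement A,
    #|` A| = (size S * size S)%N,
    (forall g : nat -> int, \sum_(P <- multi A) g (mult A P) =
       (size S * size S + size S)%N%:Z * g (size S))
  & forall P, (mult A P <= size S)%N].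
Proof.
move=> uS S1 [SB SM SV].
pose l (a b : k) := line_of (row3 a (-1) b).
have lin a b : is_line (l a b).
  exists (row3 a (-1) b) => //; apply/eqP => /matrixP/(_ 0 1)/eqP.
  by rewrite !mxE /= oppr_eq0 oner_eq0.
have n0 x y : row3 x y 1 != 0 :> 'rV[k]_3.
  by apply/eqP => /matrixP/(_ 0 2)/eqP; rewrite !mxE oner_eq0.
have n1 a : row3 1 a 0 != 0 :> 'rV[k]_3.
  by apply/eqP => /matrixP/(_ 0 0)/eqP; rewrite !mxE oner_eq0.
have in_l0 x y a b : (pt (row3 x y 1) \in l a b) = (b == y - a * x).
  by rewrite line_of_pt // dot3E !mxE /= -[RHS]subr_eq0; congr (_ == 0); ring.
have in_l1 a a' b : (pt (row3 1 a 0) \in l a' b) = (a' == a).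
  by rewrite line_of_pt // dot3E !mxE /= -[RHS]subr_eq0; congr (_ == 0); ring.
have inj_l a b a' b' : l a b = l a' b' -> (a, b) = (a', b').
  by move=> /line_of_affine_inj[-> ->].
pose A := [fset L in [seq l a b | a <- S, b <- S]]%fset.
have inA L : (L \in A) = (L \in [seq l a b | a <- S, b <- S]) by rewrite inE.
have cA : #|` A| = (size S * size S)%N.
  rewrite card_fseq undup_id ?size_allpairs // allpairs_uniq //.
  by move=> [a b] [a' b'] _ _ /= /inj_l.
have linA : line_arrangement A.
  split; first by rewrite cA; nia.
  by move=> L; rewrite inA => /allpairsP[[a b] [_ _ ->]].
pose M := [seq pt (row3 x y 1) | x <- S, y <- S] ++ [seq pt (row3 1 a 0) | a <- S].
have uM : uniq M.
  rewrite cat_uniq allpairs_uniq //=; last first.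
    move=> [x y] [x' y'] _ _ /= /(pt_eq (n0 _ _) (n0 _ _))[c /matrixP cE].
    have := cE 0 2; rewrite !mxE /= mulr1 => c1.
    have := cE 0 0; have := cE 0 1.
    by rewrite !mxE /= -c1 !mul1r => -> ->.
  apply/andP; split.
    apply/hasPn => _ /mapP[a _ ->]; apply/negP => /allpairsP[[x y] [_ _ /=]].
    move=> /(pt_eq (n1 _) (n0 _ _))[c /matrixP/(_ 0 2)/eqP].
    by rewrite !mxE /= mulr0 oner_eq0.
  rewrite map_inj_uniq // => a a' /(pt_eq (n1 _) (n1 _))[c /matrixP cE].
  have := cE 0 0; rewrite !mxE /= mulr1 => c1.
  by have := cE 0 1; rewrite !mxE /= -c1 mul1r => ->.
have cM : size M = (size S * size S + size S)%N.
  by rewrite size_cat size_allpairs size_map.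
have S0 : 0 \in S.
  have [x xS] : exists x, x \in S.
    by case: (S) S1 => // x S' _; exists x; rewrite mem_head.
  by rewrite -(subrr x) SB.
have SN x : x \in S -> - x \in S by move=> xS; rewrite -sub0r SB.
have SD x y : x \in S -> y \in S -> x + y \in S.
  by move=> xS yS; rewrite -[y]opprK SB ?SN.
have multM P : P \in M -> mult A P = size S.
  rewrite mem_cat => /orP[/allpairsP[[x y] [xS yS ->]] /=|/mapP[a aS ->]].
    rewrite -(size_map (fun a => l a (y - a * x))) -[X in _ = size X]undup_id; last first.
      by rewrite map_inj_uniq // => a a' /inj_l[].
    rewrite -card_fseq; congr #|` _|; apply/fsetP => L; rewrite !inE /=.
    apply/andP/mapP => [[/allpairsP[[a b] /= [aS bS ->]]]|[a aS ->]].
      by rewrite in_l0 => /eqP ->; exists a.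
    rewrite in_l0 eqxx; split=> //; apply/allpairsP; exists (a, y - a * x).
    by rewrite /= aS SB ?SM.
  rewrite -(size_map (fun b => l a b)) -[X in _ = size X]undup_id; last first.
    by rewrite map_inj_uniq // => b b' /inj_l[].
  rewrite -card_fseq; congr #|` _|; apply/fsetP => L; rewrite !inE /=.
  apply/andP/mapP => [[/allpairsP[[a' b] /= [aS' bS ->]]]|[b bS ->]].
    by rewrite in_l1 => /eqP ->; exists b.
  rewrite in_l1 eqxx; split=> //; apply/allpairsP; exists (a, b).
  by rewrite /= aS bS.
have multiM P : (1 < mult A P)%N -> P \in M.
  move=> /multP[L [L' []]]; rewrite !inA.
  move=> /allpairsP[[a b] /= [aS bS ->]] /allpairsP[[a' b'] /= [a'S b'S ->]].
  move=> neqL; have [v v0 ->] := ptP P.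
  rewrite !line_of_pt // !dot3E !mxE /= => /eqP ab /eqP ab'.
  have v1E : v 0 1 = a * v 0 0 + b * v 0 2.
    by apply/eqP; rewrite -subr_eq0 -oppr_eq0 -ab; apply/eqP; ring.
  have ab0 : (a - a') * v 0 0 + (b - b') * v 0 2 = 0.
    by have /eqP := etrans ab (esym ab'); rewrite -subr_eq0 => /eqP <-; ring.
  (* A common point at infinity is that of slope [a]. Otherwise the slopes differ, and x = -(b - b')
     / (a - a') and y = a x + b lie in [S]. *)
  rewrite mem_cat; apply/orP; have [v2|v2] := eqVneq (v 0 2) 0.
    right; apply/mapP; exists a => //; apply/pt_eq => //; exists (v 0 0)^-1.
    have v00 : v 0 0 != 0.
      apply: contraNneq v0 => v00; apply/eqP/row3P; rewrite mxE //.
      by rewrite v1E v00 v2; ring.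
    by apply: row3P; rewrite !mxE /= ?v1E ?v2; field.
  have aa' : a - a' != 0.
    apply: contraNneq neqL => aa'; move: ab0; rewrite aa' mul0r add0r => /eqP.
    rewrite mulf_eq0 (negPf v2) orbF subr_eq0 => /eqP ->.
    by move/eqP: aa'; rewrite subr_eq0 => /eqP ->.
  left; pose x := - (b - b') * (a - a')^-1.
  have xS : x \in S by rewrite SM ?SN ?SV ?SB.
  apply/allpairsP; exists (x, a * x + b); split=> //=.
    by apply: SD => //; apply: SM.
  apply/pt_eq => //; exists (v 0 2)^-1.
  have v00 : v 0 0 = x * v 0 2.
    apply: (mulfI aa'); rewrite /x -[LHS]addr0 -[in LHS](subrr ((b - b') * v 0 2)).
    by rewrite addrA ab0; field.
  by apply: row3P; rewrite !mxE /= ?v1E ?v00; field.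
exists A; split=> // [g|P].
  have -> : multi A = [fset P in M]%fset.
    apply/fsetP => P; rewrite in_multi // [RHS]in_fset -[RHS]/(P \in M).
    by apply/idP/idP => [/multiM //|/multM ->].
  rewrite (eq_big_seq (fun=> g (size S))); last first.
    by move=> P; rewrite in_fset => PM; rewrite multM.
  rewrite big_const_seq count_predT -Monoid.iteropE /=.
  have -> : size [fset P in M]%fset = (size S * size S + size S)%N.
    by rewrite card_fseq undup_id.
  by rewrite -natz mulr_natl.
have [/multiM/multM ->//|] := ltnP 1 (mult A P).
by move=> /leq_trans; apply; apply: ltnW.
Qed.

(** * Accumulation points *)

(** The first three bounds confine (c1^2, c2) to a finite set once d is bounded; the third comes
    from 2 c2 - c1^2 <= d - 3 and c2 > 0. *)
Lemma chern_slope_bounds (k : fieldType) (A : {fset set (proj_plane k)}) :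
    line_arrangement A -> tnum A #|` A| = 0%N -> tnum A #|` A|.-1 = 0%N ->
  [/\ 0 < chern2 A <= (#|` A| * #|` A|)%N%:Z, chern1sq A <= 3 * chern2 A,
      - #|` A|%:Z <= chern1sq A
    & forall n : nat, ((n + 1) * (n + 2) < #|` A|)%N ->
      n%:Z * (2 * chern2 A - chern1sq A) <= chern2 A].
Proof.
move=> linA td td1; have degA := degree_inc_of_bounds linA td td1.
have meetA := lines_meet_inc_of linA; have [d2 _] := linA.
rewrite chern1sq_inc // chern2_inc //; rewrite cardfE in d2 *.
have c2_gt0 := inc_chern2_gt0 meetA degA d2.
split.
- rewrite c2_gt0 inc_chern2_le // => Q.
  by case/andP: (degA Q) => /ltnW.
- apply: inc_chern_slope_le3 => // P; have := degA P.
  by move: #|_| (degree _ _) => d m; lia.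
- have : 2 * inc_chern2 (@inc_of k A) - inc_chern1sq (@inc_of k A) <=
      #|{: A}|%:Z - 3.
    rewrite inc_chernB gerBl; apply: sumr_ge0 => Q _.
    by have := degA Q; lia.
  by move: c2_gt0; move: #|_| (inc_chern2 _) (inc_chern1sq _) => d c2 c1; lia.
- by move=> n dn; apply: inc_chern_slope_ge.
Qed.

Lemma chern_slopes_le3 (R : realType) (k : fieldType) s :
  chern_slopes R k s -> s <= 3.
Proof.
move=> [A [linA td td1 ->]].
have [/andP[c2 _] c13 _ _] := chern_slope_bounds linA td td1.
by rewrite /chern_slope ler_pdivrMr ?ltr0z // -[3]/(3%:~R) -intrM ler_int.
Qed.

(** Choose n with 1 / n <= 2 - a. A slope below [a] forces d <= (n + 1) (n + 2), and then both Chern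
    numbers take finitely many values. *)
Lemma finite_chern_slopes_lt2 (R : realType) (k : fieldType) (a : R) : a < 2 ->
  finite_set [set s | chern_slopes R k s /\ s < a].
Proof.
move=> a2; pose n := (Num.truncn (2 - a)^-1).+1.
have a2n : a <= 2 - n%:R^-1.
  rewrite lerBrDr -lerBrDl -[leRHS]invrK lef_pV2 ?posrE ?invr_gt0 ?subr_gt0 //.
  by rewrite ltW // truncnS_gt.
pose D := ((n + 1) * (n + 2))%N; pose N := (D * D)%N.
(* Adding [N] >= d makes c1^2 a natural number, at most 4 N since c1^2 <= 3 c2 <= 3 N. *)
apply: (@sub_finite_set _ _ ((fun ij : nat * nat => (ij.1%:R - N%:R) / ij.2%:R : R)
   @` (`I_(4 * N).+1 `*` `I_N.+1))); last first.
  by apply/finite_image/finite_setX; apply: finite_II.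
move=> s [[A [linA td td1 ->]] sa].
have [/andP[c2 c2d] c13 c1d slope] := chern_slope_bounds linA td td1.
have dD : (#|` A| <= D)%N.
  rewrite leqNgt; apply/negP => /slope le2.
  have : 2 - n%:R^-1 <= chern_slope R A.
    rewrite /chern_slope ler_pdivlMr ?ltr0z // mulrBl lerBlDr -lerBlDl.
    rewrite -(ler_pM2l (x := n%:R)) ?ltr0n // mulrA mulfV ?mul1r ?pnatr_eq0 //.
    rewrite -[n%:R]/(n%:Z%:~R) -[2]/(2%:~R) -intrM -intrB -intrM ler_int.
    exact: le2.
  by rewrite leNgt (lt_le_trans sa a2n).
have d2N : (#|` A| * #|` A| <= N)%N by apply: leq_mul.
have dN : (#|` A| <= N)%N.
  by apply: leq_trans d2N; rewrite leq_pmull // lt0n; case: linA; lia.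
exists (absz (chern1sq A + N%:Z), absz (chern2 A)) => /=.
  by split=> /=; move: #|` A| N c2d c13 c1d d2N dN => d M; lia.
rewrite /chern_slope; congr (_ / _).
  apply/eqP; rewrite subr_eq -[N%:R]/(N%:Z%:~R) -intrD natr_absz ger0_norm //.
  by move: #|` A| N c1d d2N dN => d M; lia.
by rewrite natr_absz gtr0_norm.
Qed.

(** * Density of the slopes between 2 and 3 *)

(** This is the slope of the q^2 affine lines over F_q, q = p^n, with [s] general lines added.
    Dividing both Chern numbers by q^3 turns them into polynomials in u = 1 / q and w = s / q. *)
Lemma exists_chern_slope (R : realType) (K : closedFieldType) (p n s : nat) :
    p \in [pchar K] -> (0 < n)%N ->
  let u : R := (p%:R ^+ n)^-1 in let w : R := s%:R * u in
  chern_slopes R K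
   ((9 * u ^+ 3 - 5 * u - 5 * w * u ^+ 2 + (1 + u) * (3 - 4 * u) + 2 * w
      + (w ^+ 2 * u - w * u ^+ 2)) /
    (3 * u ^+ 3 - 2 * u - 2 * w * u ^+ 2 + (1 + u) * (1 - u) + w
      + (w ^+ 2 * u - w * u ^+ 2) / 2)).
Proof.
move=> pK n0 u w.
have binE : ('C(s, 2))%:R = (s%:R * (s%:R - 1)) / 2 :> R.
  elim: (s) => [|s' IH]; first by rewrite bin0n !mul0r.
  by rewrite binS bin1 natrD IH -[s'.+1]addn1 natrD; field.
have [S [uS sS affS]] := frobenius_fixed_points pK n0.
set q := (p ^ n)%N in sS.
have q1 : (1 < q)%N by rewrite -(exp1n n) ltn_exp2r ?prime_gt1 ?(pcharf_prime pK).
have [|A [linA cA gA mA]] := affine_lines_arrangement uS _ affS.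
  by rewrite sS.
have [B [linB cB gB mB]] := add_generic_lines s linA.
rewrite sS in cA gA mA; rewrite cA in cB gB.
have mBq P : (mult B P <= q)%N.
  by rewrite (leq_trans (mB P)) // geq_max q1 mA.
exists B; split=> //.
(* All multiplicities are at most q, whereas d - 1 >= q^2 - 1 > q. *)
- apply/tnum_eq0 => // [|P]; first by case: linB.
  by rewrite neq_ltn cB; have := mBq P; nia.
- apply/tnum_eq0 => // [|P]; first by rewrite cB; nia.
  by rewrite neq_ltn cB; have := mBq P; nia.
rewrite /chern_slope.
have q0 : (q%:R : R) != 0 by rewrite pnatr_eq0; lia.
have natE m : (m%:R : int)%:~R = m%:R :> R by rewrite natz.
have PoszE m : (Posz m)%:~R = m%:R :> R by [].
have uE : u = q%:R^-1 by rewrite /u natrX.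
have -> : (chern1sq B)%:~R = q%:R ^+ 3 * (9 * u ^+ 3 - 5 * u - 5 * w * u ^+ 2
   + (1 + u) * (3 - 4 * u) + 2 * w + (w ^+ 2 * u - w * u ^+ 2)) :> R.
  rewrite /chern1sq (sum_tnum (fun m => 3 * m%:Z - 4) linB).
  rewrite (gB (fun m => 3 * m%:Z - 4)) (gA (fun m => 3 * m%:Z - 4)) cB.
  rewrite !(intrD, mulrNz, intrM, natE, PoszE) !(natrD, natrM) binE.
  by rewrite /w uE; field.
have -> : (chern2 B)%:~R = q%:R ^+ 3 * (3 * u ^+ 3 - 2 * u - 2 * w * u ^+ 2
   + (1 + u) * (1 - u) + w + (w ^+ 2 * u - w * u ^+ 2) / 2) :> R.
  rewrite /chern2 (sum_tnum (fun m => m%:Z - 1) linB).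
  rewrite (gB (fun m => m%:Z - 1)) (gA (fun m => m%:Z - 1)) cB.
  rewrite !(intrD, mulrNz, intrM, natE, PoszE) !(natrD, natrM) binE.
  by rewrite /w uE; field.
by rewrite -[RHS]mulf_div mulfV ?expf_neq0 // mul1r.
Qed.

Lemma chern_slopes_dense (R : realType) (K : closedFieldType) (p : nat) (a b : R) :
    p \in [pchar K] -> 2 <= a -> a < b -> b <= 3 ->
  exists s, chern_slopes R K s /\ a < s < b.
Proof.
move=> pK a2 ab b3; have p1 := prime_gt1 (pcharf_prime pK).
pose y := (a + b) / 2; have y2 : 0 < y - 2 by rewrite /y; lra.
(* The solution of 2 + 1 / (1 + l) = y, positive because y < 3. *)
pose l := (y - 2)^-1 - 1.
have l0 : 0 < l by rewrite subr_gt0 invf_gt1 // /y; lra.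
pose u n : R := (p%:R ^+ n)^-1.
have u0 n : 0 < u n by rewrite invr_gt0 exprn_gt0 // ltr0n ltnW.
(* Here s is the integer part of l q, so that w lies between l - u and l. *)
pose w n : R := (Num.truncn (l * p%:R ^+ n))%:R * u n.
have cu : u n @[n --> \oo] --> (0 : R).
  rewrite /u; under eq_fun do rewrite -exprVn.
  apply: cvg_expr; rewrite ger0_norm ?invr_ge0 // invf_lt1 ?ltr0n ?(ltnW p1) //.
  by rewrite ltr1n.
have cw : w n @[n --> \oo] --> l.
  apply: (@squeeze_cvgr _ _ _ _ (fun n => l - u n) (fun=> l)); last first.
  - exact: cvg_cst.
  - by rewrite -[X in _ --> X]subr0; apply: cvgB => //; apply: cvg_cst.
  near=> n; have pn : 0 < p%:R ^+ n :> R by rewrite -invr_gt0 u0.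
  have /andP[tl tg] := truncn_itv (ltW (mulr_gt0 l0 pn)).
  rewrite -(ler_pM2r pn) -[X in _ && X](ler_pM2r pn) /w /u mulrBl mulfVK ?gt_eqF //.
  by rewrite mulVf ?gt_eqF // tl andbT lerBlDr natr1 ltW.
pose F (u w : R) := (9 * u ^+ 3 - 5 * u - 5 * w * u ^+ 2 + (1 + u) * (3 - 4 * u)
  + 2 * w + (w ^+ 2 * u - w * u ^+ 2)) /
    (3 * u ^+ 3 - 2 * u - 2 * w * u ^+ 2 + (1 + u) * (1 - u) + w
      + (w ^+ 2 * u - w * u ^+ 2) / 2).
have cF : F (u n) (w n) @[n --> \oo] --> F 0 l.
  have cX v m (vl : R) : v n @[n --> \oo] --> vl ->
      v n ^+ m @[n --> \oo] --> vl ^+ m.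
    move=> cv; apply: (@cvg_comp _ _ _ v (fun x => x ^+ m)) cv _.
    exact: exprn_continuous.
  rewrite /F; apply: cvgM; last apply: cvgV.
  - by repeat first [exact: cvg_cst | exact: cu | exact: cw | apply: cX
      | apply: cvgD | apply: cvgN | apply: cvgM].
  - by apply/eqP; lra.
  - by repeat first [exact: cvg_cst | exact: cu | exact: cw | apply: cX
      | apply: cvgD | apply: cvgN | apply: cvgM].
have Fy : F 0 l = y.
  rewrite /F !expr0n /= !(mulr0, mul0r, subr0, addr0, add0r, mul1r).
  by rewrite /l; field; apply/andP; split; apply/eqP; lra.
rewrite Fy in cF.
have near_ab : \forall n \near \oo, a < F (u n) (w n) < b.
  near=> n; apply/andP; split; near: n.
    by apply: (cvgr_gt _ cF); rewrite /y; lra.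
  by apply: (cvgr_lt _ cF); rewrite /y; lra.
have [n [n0 Fab]] : exists n, (0 < n)%N /\ a < F (u n) (w n) < b.
  have [N _ FN] := near_ab.
  (* The successor makes the exponent of p positive. *)
  by exists N.+1; split=> //; apply: FN => /=.
exists (F (u n) (w n)); split=> //.
exact: exists_chern_slope.
Unshelve. all: by end_near.
Qed.

Theorem corollary4p3 (R : realType) (p : nat) (p_prime : prime p)
    (K : closedFieldType) (iota : {rmorphism 'F_p -> K})
    (K_alg : is_algebraic_closure iota) :
  limit_point (chern_slopes R K) = [set x : R | 2 <= x <= 3].
Proof.
have pK : p \in [pchar K] by rewrite (fmorph_pchar iota) pchar_Fp.
apply/seteqP; split=> [x limx|x /= /andP[x2 x3] U /nbhs_ballP[e /= e0 eU]].
  (* Around a point below 2, the slopes less than (x + 2) / 2 would be infinitely many; around a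
     point above 3 there are none. *)
  apply/andP; split; rewrite leNgt; apply/negP => ltx.
    have mid : (x + 2) / 2 < 2 by lra.
    have Ux : nbhs x [set y | y < (x + 2) / 2] by apply: lt_nbhsl; lra.
    have /limit_point_infinite_setP/(_ _ Ux) := limx; apply.
    by apply: sub_finite_set (finite_chern_slopes_lt2 K mid) => y [].
  have [y [_ /chern_slopes_le3 y3 /=]] := limx _ (lt_nbhsr ltx).
  by rewrite ltNge y3.
(* A slope distinct from [x] is sought on its right if x < 3, and on its left if x = 3. *)
have [xlt3|x3'] := ltP x 3.
  have xm : x < Num.min (x + e) 3 by rewrite lt_min xlt3 andbT ltrDl.
  have [|s [Ks /andP[xs]]] := chern_slopes_dense pK x2 xm.
    by rewrite ge_min lexx orbT.
  rewrite lt_min => /andP[se _]; exists s; split=> //; first by rewrite gt_eqF.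
  by apply: eU; rewrite /ball /= ltr_norml; lra.
have mx : Num.max 2 (x - e) < x by rewrite gt_max ltrBlDr ltrDl; lra.
have [|s [Ks /andP[]]] := chern_slopes_dense pK _ mx x3.
  by rewrite le_max lexx.
rewrite gt_max => /andP[_ es] sx; exists s; split=> //; first by rewrite lt_eqF.
by apply: eU; rewrite /ball /= ltr_norml; lra.
Qed.
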